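(* Let $m$ be a positive integer with $m\not\equiv 0\pmod 3$, let $n=2m$, and let $\delta\in\mathbb{F}_{2^n}$. Let $F(X)=(X^{2^m}+X+\delta)^{3\cdot 2^{2m-2}+2^{m-2}}+X$, viewed as a function $\mathbb{F}_{2^n}\to\mathbb{F}_{2^n}$. Then $F$ is P$c$N for every $c\in\mathbb{F}_{2^m}\setminus\{1\}$.
   Context: For $F:\mathbb{F}_q\to\mathbb{F}_q$ and $a,b,c\in\mathbb{F}_q$, let ${}_c\Delta_F(a,b)$ be the number of $X\in\mathbb{F}_q$ with $F(X+a)-cF(X)=b$. The $c$-differential uniformity of $F$ is ${}_c\Delta_F=\max\{{}_c\Delta_F(a,b): a,b\in\mathbb{F}_q,\ a\neq 0 \text{ if } c=1\}$. $F$ is perfect $c$-nonlinear (P$c$N) if ${}_c\Delta_F=1$. *)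

(* Defs.v *)
From mathcomp Require Export all_boot all_algebra.

Set Implicit Arguments.
Unset Strict Implicit.
Unset Printing Implicit Defensive.

Import GRing.Theory.
Local Open Scope ring_scope.

Definition cDelta_count (K : finFieldType) (F : K -> K) (c a b : K) : nat :=
  #|[set X : K | F (X + a) - c * F X == b]|.

Definition c_diff_uniformity (K : finFieldType) (F : K -> K) (c : K) : nat :=
  (\max_(ab : K * K | (c == 1%R) ==> (ab.1 != 0%R))
     cDelta_count F c ab.1 ab.2)%N.

Definition PcN (K : finFieldType) (F : K -> K) (c : K) : Prop :=
  c_diff_uniformity F c = 1%N.

(* The exponent 3 * 2 ^ (2m - 2) + 2 ^ (m - 2).  For m = 1 the second term is
   2 ^ (-1), and Y ^ (1/2) is the square root on F_(2^(2m)), i.e., the inverse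
   of the Frobenius map, Y |-> Y ^ (2 ^ (2m - 1)).  (Truncated subtraction would
   wrongly give Y ^ 1.) *)
Definition F_exponent (m : nat) : nat :=
  (3 * 2 ^ (2 * m - 2) + (if 2 <= m then 2 ^ (m - 2) else 2 ^ (2 * m - 1)))%N.

Definition F_fun (K : finFieldType) (m : nat) (delta : K) (X : K) : K :=
  (X ^+ (2 ^ m) + X + delta) ^+ F_exponent m + X.

(* Main.v *)
Require Import Defs.
From mathcomp Require Import all_boot all_algebra.
From mathcomp Require Import finfield ring.

Set Implicit Arguments.
Unset Strict Implicit.
Unset Printing Implicit Defensive.

Import GRing.Theory.
Local Open Scope ring_scope.

(** Write [T z = z + z^(2^m)] for the trace to the subfield.  The exponent [d]
    satisfies [(z^d)^4 = z^3 z^(2^m)], so [T (z^d)^4] is the norm of [z] times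
    [T(z)^2].  Hence, if [z] and [z + t] with [t] in the subfield have trace [h],
    the difference [g] of the traces of their [d]-th powers satisfies
    [g^4 = h^2 (t^2 + h t)], whatever [z] is.  Taking traces in
    [F(X+a) - F(Y+a) = c (F X - F Y)] gives [(1 + c) t = (1 + c) g] for
    [t = T(X - Y)], hence [t^4 = h^2 t^2 + h^3 t].  A solution [t != 0] would
    make [t / h] a root of [w^3 + w + 1], which generates [F_8]; this is excluded
    by [3] not dividing [m].  So [t = 0], and then [X = Y]. *)

Lemma divring_closed_expf (K : finFieldType) (k : {set K}) (c : K) :
  divring_closed k -> c \in k -> c ^+ #|k| = c.
Proof.
move=> [k1 kB kV] kc.
have k0 : 0 \in k by rewrite -(subrr 1) kB.
have kM : {in k &, forall x y, x * y \in k}.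
  move=> x y kx ky; rewrite -[y]invrK; apply: (kV) => //.
  by rewrite -[y^-1]mul1r; apply: kV.
have [->|c0] := eqVneq c 0.
  by rewrite (cardsD1 0 k) k0 expr0n.
have dom x : (c * x \in k :\ 0) = (x \in k :\ 0).
  rewrite !inE mulf_eq0 (negPf c0) /=; congr (_ && _).
  apply/idP/idP => [kcx|]; last exact: kM.
  by rewrite -(mulKf c0 x) mulrC; apply: kV.
have nz : \prod_(x in k :\ 0) x != 0.
  by apply/prodf_neq0 => x; rewrite !inE => /andP[].
(* Multiplication by [c != 0] permutes the nonzero elements of [k]; comparing their product before
   and after gives [c ^+ #|k :\ 0| = 1]. *)
have := reindex_inj (mulfI c0) (x := 1) (op := *%R)
  (P := fun x => x \in k :\ 0) (F := id).
rewrite (eq_bigl _ _ dom) big_split prodr_const /= => E.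
rewrite (cardsD1 0 k) k0 add1n exprS.
suff -> : c ^+ #|k :\ 0| = 1 by rewrite mulr1.
by apply: (mulIf nz); rewrite mul1r -E.
Qed.

Definition rel_trace (K : finFieldType) (m : nat) (z : K) : K :=
  z ^+ (2 ^ m) + z.

Section EvenDegree.

Variables (K : finFieldType) (m : nat).
Hypotheses (m_gt0 : (0 < m)%N) (cardK : #|K| = (2 ^ (2 * m))%N).

Let char2 : 2 \in [pchar K]. Proof. exact: card_finPcharP cardK isT. Qed.

Local Notation T := (@rel_trace K m).

Lemma expr2nD i (x y : K) : (x + y) ^+ (2 ^ i) = x ^+ (2 ^ i) + y ^+ (2 ^ i).
Proof. by rewrite exprDn_pchar // pnatX pnatE ?char2. Qed.

Lemma expr4_inj : injective (fun x : K => x ^+ 4).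
Proof.
move=> x y /= E; apply/eqP; rewrite -subr_eq0.
suff : (x - y) ^+ (2 ^ 2) == 0 by rewrite expf_eq0.
by rewrite (oppr_pchar2 char2) expr2nD E (addrr_pchar2 char2).
Qed.

Lemma conjK (x : K) : (x ^+ (2 ^ m)) ^+ (2 ^ m) = x.
Proof. by rewrite -exprM -expnD addnn -mul2n -cardK expf_card. Qed.

Lemma traceD x y : T (x + y) = T x + T y.
Proof. by rewrite /rel_trace expr2nD; ring. Qed.

Lemma traceB x y : T (x - y) = T x - T y.
Proof. by rewrite !(oppr_pchar2 char2) traceD. Qed.

Lemma trace_fixed x : T x ^+ (2 ^ m) = T x.
Proof. by rewrite /rel_trace expr2nD conjK addrC. Qed.

Lemma traceZ c x : c ^+ (2 ^ m) = c -> T (c * x) = c * T x.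
Proof. by move=> hc; rewrite /rel_trace exprMn hc mulrDr. Qed.

Lemma trace_of_fixed t : t ^+ (2 ^ m) = t -> T t = 0.
Proof. by move=> ht; rewrite /rel_trace ht (addrr_pchar2 char2). Qed.

(** For [2 <= m], four times the exponent is [3 * 2 ^ (2 * m) + 2 ^ m], and raising to the power
    [2 ^ (2 * m) = #|K|] is the identity. *)
Lemma expr_F_exponent4 (z : K) :
  (z ^+ F_exponent m) ^+ 4 = z ^+ 3 * z ^+ (2 ^ m).
Proof.
rewrite -exprM /F_exponent mulnDl exprD; congr (_ * _).
  rewrite -mulnA -[4%N]/(2 ^ 2)%N -expnD subnK; last first.
    by rewrite -[X in (X <= _)%N]muln1 leq_mul2l.
  by rewrite -cardK mulnC exprM expf_card.
case: leqP => [m1|m2]; last by rewrite -[4%N]/(2 ^ 2)%N -expnD subnK.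
(* Here the second term of the exponent is 2, and [z ^+ 8 = z ^+ 2] because [z ^+ 4 = z] in the
   field of four elements. *)
have m_1 : m = 1%N by apply/eqP; rewrite eqn_leq m_gt0 m1.
have := expf_card z; rewrite cardK m_1 -[(2 ^ (2 * 1))%N]/4%N => E.
by rewrite -[(_ * 4)%N]/(4 * 2)%N exprM E.
Qed.

Lemma trace_F_exponent4 (z : K) :
  T (z ^+ F_exponent m) ^+ 4 = z * z ^+ (2 ^ m) * T z ^+ 2.
Proof.
rewrite [LHS](expr2nD 2) -exprM mulnC exprM [(2 ^ 2)%N]/= expr_F_exponent4.
rewrite exprMn -exprM mulnC exprM conjK.
by rewrite /rel_trace [X in _ = _ * X](expr2nD 1) [(2 ^ 1)%N]/=; ring.
Qed.

Lemma trace_F_exponent_diff4 (z t : K) : t ^+ (2 ^ m) = t ->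
  (T ((z + t) ^+ F_exponent m) - T (z ^+ F_exponent m)) ^+ 4
    = T z ^+ 2 * (t ^+ 2 + T z * t).
Proof.
move=> ht; rewrite (oppr_pchar2 char2) [LHS](expr2nD 2) [(2 ^ 2)%N]/= !trace_F_exponent4 traceD.
rewrite (trace_of_fixed ht) addr0 expr2nD ht.
set N := z * _; rewrite -mulrDl mulrC; congr (_ * _).
(* The norm [N] of [z] is the only term not determined by [t] and [T z], and it cancels in
   characteristic 2. *)
have -> : (z + t) * (z ^+ (2 ^ m) + t) = N + (t ^+ 2 + T z * t).
  by rewrite /N /rel_trace; ring.
by rewrite addrAC (addrr_pchar2 char2) add0r.
Qed.

(** A root is fixed by the third and the [m]-th iterate of squaring. As 3 is prime to [m], squaring
    itself fixes it, so it is 0 or 1, and neither is a root. *)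
Lemma cubic_no_root (w : K) : ~~ (3 %| m)%N -> w ^+ (2 ^ m) = w ->
  w ^+ 3 + w + 1 != 0.
Proof.
move=> m3 wm; apply/eqP => w3.
have add2 x : x + x = 0 :> K by exact: addrr_pchar2.
have w3E : w ^+ 3 = w + 1.
  apply/eqP; rewrite -subr_eq0 (oppr_pchar2 char2).
  by rewrite addrA w3.
have w4 : w ^+ 4 = w ^+ 2 + w by rewrite exprS w3E; ring.
have w8 : w ^+ (2 ^ 3) = w.
  rewrite -[(2 ^ 3)%N]/(4 * 2)%N exprM w4 [LHS](expr2nD 1) -exprM.
  by rewrite [(2 * 2 ^ 1)%N]/= w4 [(2 ^ 1)%N]/= addrAC add2 add0r.
have wr : w ^+ (2 ^ (m %% 3)) = w.
  have w8n j : w ^+ (2 ^ (j * 3)) = w.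
    by elim: j => // j IH; rewrite mulSn expnD exprM w8.
  by rewrite -[in RHS]wm {2}(divn_eq m 3) expnD exprM w8n.
have w2 : w ^+ 2 = w.
  move: wr m3; rewrite /dvdn; have := ltn_pmod m (isT : 0 < 3)%N.
  (* Remainder 1 is immediate; remainder 2 gives [w ^+ 4 = w], whence [w = w ^+ 8 = w ^+ 2]. *)
  case: (m %% 3)%N => [//|[//|[|//]]] _ w4' _.
  by rewrite -[RHS]w8 -[(2 ^ 3)%N]/((2 ^ 2) * 2)%N exprM w4'.
move/eqP: w3; rewrite exprS w2 -expr2 w2 add2 add0r.
by rewrite oner_eq0.
Qed.

Lemma quartic_only_root0 (h t : K) : ~~ (3 %| m)%N ->
  h ^+ (2 ^ m) = h -> t ^+ (2 ^ m) = t ->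
  t ^+ 4 = h ^+ 2 * (t ^+ 2 + h * t) -> t = 0.
Proof.
move=> m3 hh ht E; have [//|t0] := eqVneq t 0.
have [h0|h0] := eqVneq h 0.
  by move/eqP: E; rewrite h0 expr0n mul0r expf_eq0 (negPf t0).
have /eqP[] : (t / h) ^+ 3 + t / h + 1 != 0.
  by apply: cubic_no_root => //; rewrite exprMn exprVn hh ht.
(* This factor clears denominators and turns the cubic in [t / h] into
   [t ^+ 4 + h ^+ 2 * t ^+ 2 + h ^+ 3 * t]. *)
apply: (mulfI (x := t * h ^+ 3)); first by rewrite mulf_neq0 // expf_neq0.
rewrite mulr0 -(addrr_pchar2 char2 (t ^+ 4)) {2}E.
by field.
Qed.

Lemma F_fun_cdiff_inj (delta c a : K) : ~~ (3 %| m)%N ->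
  c ^+ (2 ^ m) = c -> c != 1 ->
  injective (fun X => F_fun m delta (X + a) - c * F_fun m delta X).
Proof.
move=> m3 hc c1 X Y /=; pose y Z := Z ^+ (2 ^ m) + Z + delta.
pose g z := T (z ^+ F_exponent m).
pose t := T (X - Y); pose h := T delta.
have tm : t ^+ (2 ^ m) = t by exact: trace_fixed.
have hy Z : T (y Z) = h.
  by rewrite /y traceD trace_of_fixed ?add0r //; exact: trace_fixed.
have yD Z : y (X + Z) = y (Y + Z) + t.
  have -> : X + Z = Y + Z + (X - Y) by ring.
  by rewrite /y /t /rel_trace [X in X + _ + _](expr2nD m (Y + Z)); ring.
have g4 Z : (g (y (X + Z)) - g (y (Y + Z))) ^+ 4 = h ^+ 2 * (t ^+ 2 + h * t).
  by rewrite yD trace_F_exponent_diff4 // hy.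
(* The right side of [g4] does not involve [Z], and fourth powers are injective, so the shift by [a]
   leaves the difference unchanged. *)
have ga : g (y (X + a)) - g (y (Y + a)) = g (y X) - g (y Y).
  by apply: expr4_inj; rewrite /= g4 -(g4 0) !addr0.
have c1' : 1 - c != 0 by rewrite subr_eq0 eq_sym.
rewrite /F_fun -!/(y _) => E.
have tg : t = - (g (y X) - g (y Y)).
  apply/eqP; rewrite -subr_eq0 -(mulrI_eq0 _ (mulfI c1')); apply/eqP.
  have /eqP := congr1 T E; rewrite -subr_eq0 !traceB !traceZ // !traceD -!/(g _).
  move=> /eqP <-; rewrite (canRL (subrK _) ga) /t traceB.
  by ring.
have t0 : t = 0.
  apply: (@quartic_only_root0 h) => //; first exact: trace_fixed.
  by rewrite {1}tg -(g4 0) !addr0; ring.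
(* With [t = 0] the power terms of [F_fun] agree at [X] and [Y], also after the shift, so [E]
   reduces to [(1 - c) * (X - Y) = 0]. *)
have yE Z : y (X + Z) = y (Y + Z) by rewrite yD t0 addr0.
have := yE 0; rewrite !addr0 => yE0.
apply/eqP; rewrite -subr_eq0 -(mulrI_eq0 _ (mulfI c1')); apply/eqP.
move/eqP: E; rewrite -subr_eq0 yE yE0 => /eqP <-.
by ring.
Qed.

End EvenDegree.

Theorem theorem3p2 (m n : nat) (hm : (0 < m)%N) (hm3 : ~~ (3 %| m)%N)
    (hn : n = (2 * m)%N)
    (K : finFieldType) (cardK : #|K| = (2 ^ n)%N)
    (k : {set K}) (subfield_k : divring_closed k) (card_k : #|k| = (2 ^ m)%N)
    (delta : K) :
  forall c : K, c \in k -> c != 1 -> PcN (F_fun m delta) c.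
Proof.
move=> c kc c1; subst n.
have hc : c ^+ (2 ^ m) = c by rewrite -card_k divring_closed_expf.
apply/eqP; rewrite eqn_leq; apply/andP; split.
  apply/bigmax_leqP => -[a b] _; rewrite /cDelta_count /=.
  apply/card_le1_eqP => X Y; rewrite !inE => /eqP EX /eqP EY.
  apply: (F_fun_cdiff_inj hm cardK hm3 hc c1 (delta := delta) (a := a)).
  by rewrite EX EY.
(* For the lower bound, the shift [a = 0] is admissible since [c != 1], and [b] is chosen so that
   [X = 0] is a solution. *)
pose b := F_fun m delta (0 + 0) - c * F_fun m delta 0.
apply: (@leq_trans (cDelta_count (F_fun m delta) c 0 b)).
  by rewrite card_gt0; apply/set0Pn; exists 0; rewrite inE.
by apply: (leq_bigmax_cond (0, b)); rewrite (negPf c1).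
Qed.
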